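(* Let $k\ge 3$ and let $C_k$ be the cyclic graph on $k$ vertices. For each $n\geq 1$, the automorphism group of the $n$-th Schreier graph $\Gamma_n^{C_k}$ of the graph automaton group $\mathcal{G}_{C_k}$ satisfies $$Aut(\Gamma_{n}^{C_k})\cong Aut(C_k)\cong D_{2k},$$ where $D_{2k}$ is the dihedral group with $2k$ elements.
   Context: Graph automaton group: given a finite simple graph $G=(V,E)$, choose an orientation of every edge and let $E'$ be the resulting set of ordered pairs. Let $V^n$ be the set of words of length $n$ over the alphabet $V$ and $V^*=\bigcup_{n\ge0}V^n$. Each oriented edge $e=(x,y)\in E'$ acts as a length-preserving bijection of $V^*$ defined recursively by $e(\emptyset)=\emptyset$, $e(xw)=y\,e(w)$, $e(yw)=xw$, and $e(zw)=zw$ for $z\in V\setminus\{x,y\}$, $w\in V^*$. The group $\mathcal{G}_G$ is the group of bijections of $V^*$ generated by the elements of $E'$ (it does not depend on the orientation). The $n$-th Schreier graph $\Gamma_n^G$ is the graph with vertex set $V^n$ in which $u$ and $v$ are joined by an edge if $v=e(u)$ or $v=e^{-1}(u)$ for some $e\in E'$. It is regarded as an undirected, unlabeled graph, and only adjacency of distinct vertices matters (loops and edge multiplicities are disregarded), so an automorphism is a permutation of $V^n$ preserving adjacency. This graph does not depend on the orientation. *)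

(* Defs.v *)
From HB Require Import structures.
From mathcomp Require Import all_boot all_fingroup all_solvable.

Set Implicit Arguments.
Unset Strict Implicit.
Unset Printing Implicit Defensive.

Local Open Scope group_scope.

(* A finite simple graph on T is a symmetric irreflexive relation e : rel T. *)

Section GraphAut.

Variables (T : finType) (e : rel T).

Definition graph_aut : {set {perm T}} :=
  [set s : {perm T} | [forall u, forall v, e (s u) (s v) == e u v]].

Lemma graph_autP (s : {perm T}) :
  reflect (forall u v, e (s u) (s v) = e u v) (s \in graph_aut).
Proof.
rewrite inE; apply: (iffP 'forall_forallP) => [h u v | h u v].
  exact: (eqP (h u v)).
by apply/eqP.
Qed.

Lemma graph_aut_group_set : group_set graph_aut.
Proof.
apply/group_setP; split=> [|s t /graph_autP hs /graph_autP ht].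
  by apply/graph_autP => u v; rewrite !perm1.
by apply/graph_autP => u v; rewrite !permM ht hs.
Qed.

Canonical graph_aut_group := Group graph_aut_group_set.

End GraphAut.

Definition cycle_graph (k : nat) : rel 'I_k :=
  [rel i j | (j == ordS i) || (i == ordS j)].

Lemma cycle_graph_sym k : symmetric (@cycle_graph k).
Proof. by move=> i j; exact: orbC. Qed.

Lemma cycle_graph_irr k : 1 < k -> irreflexive (@cycle_graph k).
Proof.
move=> k_gt1 i; apply: (etrans (orbb _)); apply/eqP => /(congr1 val) /=.
have := ltn_ord i; rewrite leq_eqVlt => /orP[/eqP ik | ik].
  by rewrite ik modnn => i0; move: k_gt1; rewrite -ik i0.
by rewrite modn_small // => /eqP; rewrite eqn_leq ltnn andbF.
Qed.

Definition is_orientation (T : finType) (e : rel T) (E' : {set T * T}) : Prop :=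
  (forall x y, e x y = ((x, y) \in E') || ((y, x) \in E')) /\
  (forall x y, (x, y) \in E' -> (y, x) \notin E').

Section EdgeAction.

Variable V : finType.

Fixpoint edge_act (x y : V) (w : seq V) : seq V :=
  if w is z :: w' then
    if z == x then y :: edge_act x y w'
    else if z == y then x :: w'
    else z :: w'
  else [::].

Fixpoint edge_inv (x y : V) (w : seq V) : seq V :=
  if w is z :: w' then
    if z == y then x :: edge_inv x y w'
    else if z == x then y :: w'
    else z :: w'
  else [::].

Lemma size_edge_act x y w : size (edge_act x y w) = size w.
Proof. by elim: w => //= z w IHw; do 2?case: ifP => //= _; rewrite IHw. Qed.

Lemma edge_actK x y : cancel (edge_act x y) (edge_inv x y).
Proof.
elim=> //= z w IHw; have [->|zx] := eqVneq z x; first by rewrite /= eqxx IHw.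
have [zy|zy] := eqVneq z y; last by rewrite /= (negPf zx) (negPf zy).
by rewrite /= -zy eq_sym (negPf zx) eqxx.
Qed.

Lemma edge_invK x y : cancel (edge_inv x y) (edge_act x y).
Proof.
elim=> //= z w IHw; have [->|zy] := eqVneq z y; first by rewrite /= eqxx IHw.
have [zx|zx] := eqVneq z x; last by rewrite /= (negPf zx) (negPf zy).
by rewrite /= -zx eq_sym (negPf zy) eqxx.
Qed.

Variable n : nat.

Lemma edge_act_tupleP x y (w : n.-tuple V) : size (edge_act x y w) == n.
Proof. by rewrite size_edge_act size_tuple. Qed.

Definition edge_tuple x y (w : n.-tuple V) : n.-tuple V :=
  Tuple (edge_act_tupleP x y w).

Lemma edge_tuple_inj x y : injective (edge_tuple x y).
Proof.
move=> u v /(congr1 val) /= h.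
exact/val_inj/(can_inj (edge_actK x y)).
Qed.

Definition edge_perm x y : {perm n.-tuple V} := perm (@edge_tuple_inj x y).

End EdgeAction.

(* The vertex set V^n is n.-tuple V, on which the generators of the automaton
   group act by edge_perm; the condition u != v discards loops. *)
Definition schreier_graph (V : finType) (E' : {set V * V}) (n : nat) :
    rel (n.-tuple V) :=
  [rel u v | (u != v) &&
    [exists e in E', (v == edge_perm n e.1 e.2 u) ||
                     (v == (edge_perm n e.1 e.2)^-1 u)]].

(* Main.v *)
(* Splitting off the first letter of a word, the (n+1)-st Schreier graph has a
   copy of the cycle over each word w of length n (the words xw, x a letter),
   and these copies are joined by the edges xw -- y e(w) with e = (x,y) and
   e(w) <> w. If w starts with i then iw has degree 4, its two neighbours in the
   copy have degree 3 and the rest of the copy has degree 2, so the joining edges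
   are those whose ends both have degree 4, or both have degree 3 and no common
   neighbour (the latter condition matters for the triangle only). Hence every
   automorphism permutes the copies and induces an automorphism of the n-th
   Schreier graph, which by induction is a cycle automorphism applied to each
   letter. An automorphism preserving every copy is trivial: it must fix iw and
   its two neighbours in the copy over w, which are ends of joining edges. *)

Require Import Defs.
From mathcomp Require Import all_boot all_fingroup all_solvable.
From mathcomp Require Import ssralg zmodp.

Set Implicit Arguments.
Unset Strict Implicit.
Unset Printing Implicit Defensive.

Local Open Scope group_scope.

(** * Rigidity of connected 2-regular graphs *)

Section TwoRegular.

Variables (V : finType) (E : rel V).
Hypothesis E_deg : forall x, #|E x| = 2.
Hypothesis E_conn : forall x y, connect E x y.
Hypothesis E_sym : symmetric E.
Hypothesis E_irr : irreflexive E.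

Lemma other_neighbour x y : E x y -> exists2 z, E x z & z != y.
Proof.
move=> xy; have : 0 < #|[predD1 E x & y]|.
  have := cardD1 y (E x); rewrite E_deg (_ : y \in E x) // => /eqP.
  by rewrite add1n eqSS => /eqP<-.
by case/card_gt0P=> z /andP[zy xz]; exists z.
Qed.

Lemma neighbour_uniq x y z t : E x y -> E x z -> E x t ->
  y != z -> y != t -> z = t.
Proof.
move=> xy xz xt yz yt; apply/eqP/negPn/negP => zt.
have : #|[:: y; z; t]| <= #|E x|.
  by apply/subset_leq_card/subsetP => s; rewrite !inE => /or3P[] /eqP->.
by rewrite E_deg (card_uniqP _) //= !inE negb_or yz yt zt.
Qed.

(** The property that a vertex and its neighbours are all fixed spreads along paths: at a neighbour
    [z] of [x], the other neighbour of [z] must go to a neighbour of [z] distinct from [x], hence to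
    itself. *)
Lemma fix_neighbours_id (g : V -> V) x : injective g ->
    (forall y z, E y z -> E (g y) (g z)) ->
  g x = x -> (forall y, E x y -> g y = y) -> g =1 id.
Proof.
move=> g_inj gE gx gN y.
suff [] : g y = y /\ forall z, E y z -> g z = z by [].
have /connectP[p] := E_conn x y.
elim: p x gx gN => [|z p IHp] x gx gN /=; first by move=> _ ->.
case/andP=> xz pz; apply: (IHp z) => //; first exact: gN.
move=> t zt; have [->//|tx] := eqVneq t x.
have gz := gN z xz.
apply: (@neighbour_uniq z x) => //; first by rewrite E_sym.
- by rewrite -{1}gz gE.
- by rewrite -gx inj_eq // eq_sym.
- by rewrite eq_sym.
Qed.

Lemma fix_edge_id (g : V -> V) x y : injective g ->
    (forall z t, E z t -> E (g z) (g t)) -> E x y ->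
  g x = x -> g y = y -> g =1 id.
Proof.
move=> g_inj gE xy gx gy; apply: (fix_neighbours_id g_inj gE gx) => z xz.
have [->//|zy] := eqVneq z y.
apply: (@neighbour_uniq x y) => //.
- by rewrite -{1}gx gE.
- by rewrite -gy inj_eq // eq_sym.
- by rewrite eq_sym.
Qed.

(** * Automorphisms of the extension by one letter *)

Section Extension.

(** [W] models the words of a fixed positive length, [act x y] the edge (x, y) acting on them, and
    [h] the first letter, which decides whether an edge moves a word. *)
Variables (W : finType) (act : V -> V -> W -> W) (h : W -> V).
Hypothesis act_fix : forall x y u, E x y ->
  (act x y u == u) = (h u != x) && (h u != y).
Hypothesis h_actl : forall x y u, h u = x -> h (act x y u) = y.
Hypothesis h_actr : forall x y u, h u = y -> h (act x y u) = x.

(* The generator of an edge {x, y} joins yu to xu and xu to y(act x y u). *)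
Definition ext_rel : rel (V * W) := [rel p q |
  E p.1 q.1 && ((q.2 == p.2) || (q.2 == act p.1 q.1 p.2))].

Definition base_rel : rel W := [rel u v |
  (u != v) && [exists x, exists y, E x y && (v == act x y u)]].

(** Adjacency of words becomes the existence of an edge between their copies, a form that
    automorphisms of the extension transport. *)
Lemma base_relE u v :
  base_rel u v = (u != v) && [exists x, exists y, ext_rel (x, u) (y, v)].
Proof.
rewrite /base_rel /=; have [//|/= uv] := eqVneq u v.
apply: eq_existsb => x; apply: eq_existsb => y.
by rewrite /ext_rel /= [v == u]eq_sym (negPf uv).
Qed.

Lemma ext_rel_vert x y u : ext_rel (x, u) (y, u) = E x y.
Proof. by rewrite /ext_rel /= eqxx andbT. Qed.

(** Each neighbour [y] of [x] contributes [(y, u)], and a second vertex exactly when the edge moves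
    [u], that is, when [h u] is [x] or [y]. *)
Lemma ext_rel_deg x u :
  #|ext_rel (x, u)| = if h u == x then 4 else (E x (h u)).+2.
Proof.
transitivity (\sum_(y | E x y) (1 + ((h u == x) || (h u == y)))).
  rewrite -sum1_card.
  transitivity (\sum_(y | E x y) \sum_(v | pred2 u (act x y u) v) 1).
    by rewrite pair_big_dep; apply: eq_bigl => -[].
  apply: eq_bigr => y xy /=.
  by rewrite sum1_card card2 eq_sym act_fix // negb_and !negbK.
case: eqP => [_|_] /=; first by rewrite sum_nat_const E_deg.
rewrite big_split /= sum1_card E_deg; congr (2 + _).
have [xh|/negPf xh] := boolP (E x (h u)).
  by rewrite (bigD1 (h u)) //= eqxx big1 // => y /andP[_ /negPf];
      rewrite eq_sym => ->.
by apply: big1 => y xy; case: eqP xy => // <-; rewrite xh.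
Qed.

(** Only adjacency, degrees and common neighbours occur, so invariance under automorphisms is
    automatic. *)
Definition crossing (p q : V * W) := ext_rel p q &&
  ((#|ext_rel p| == 4) && (#|ext_rel q| == 4) ||
   [&& #|ext_rel p| == 3, #|ext_rel q| == 3 &
       ~~ [exists r, ext_rel p r && ext_rel q r]]).

Lemma crossingE p q : crossing p q = ext_rel p q && (p.2 != q.2).
Proof.
case: p q => [x u] [y v]; rewrite /crossing !ext_rel_deg /=.
have [/andP[/= xy uv]|//] := boolP (ext_rel (x, u) (y, v)).
have xNy : x != y by apply: contraTneq xy => ->; rewrite E_irr.
have [E_uv|/negPf vNu] /= := eqVneq v u.
  subst v.
  have [hx|hx] := eqVneq (h u) x.
    by rewrite hx (negPf xNy) E_sym xy.
  have [hy|hy] := eqVneq (h u) y; first by case: (E x _).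
  have [xh|//] := boolP (E x (h u)); have [yh|//] := boolP (E y (h u)).
  (* Two adjacent vertices of degree 3 in one copy have its vertex of degree 4 as common
     neighbour. *)
  by apply/negbF/existsP; exists (h u, u); rewrite !ext_rel_vert xh yh.
move: uv; rewrite vNu => /= /eqP E_v.
subst v; have := vNu; rewrite act_fix // => /negbT; rewrite negb_and !negbK.
have [hx _|hNx /= /eqP hy] := eqVneq (h u) x.
  by rewrite h_actl // !eqxx.
rewrite hy h_actr // (negPf xNy) xy E_sym xy /=.
(* A common neighbour has a letter [z] other than [x] and [y]. The edges {x, z} and {y, z} then fix
   the respective tails, so [t] would equal both of these distinct tails. *)
apply/existsP => -[[z t]] /andP[/andP[/= xz tu] /andP[/= yz tv]].
have zNx : z != x by apply: contraTneq xz => ->; rewrite E_irr.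
have zNy : z != y by apply: contraTneq yz => ->; rewrite E_irr.
have /eqP au : act x z u == u by rewrite act_fix // hy eq_sym xNy eq_sym zNy.
have /eqP av : act y z (act x y u) == act x y u.
  by rewrite act_fix // h_actr // xNy eq_sym zNx.
by move: tu tv; rewrite au av !orbb => /eqP-> ; rewrite eq_sym vNu.
Qed.

Section Aut.

Variable F : {perm V * W}.
Hypothesis F_aut : F \in graph_aut ext_rel.

Lemma crossing_aut p q : crossing (F p) (F q) = crossing p q.
Proof.
have FE := graph_autP _ _ F_aut.
have deg r : #|ext_rel (F r)| = #|ext_rel r|.
  transitivity #|[preim F of ext_rel (F r)]|.
    rewrite (card_preim (@perm_inj _ F)); apply: eq_card => t.
    have tF : t \in codom F by rewrite -(permKV F t) codom_f.
    by rewrite [RHS]inE /= tF.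
  by apply: eq_card => t; apply: FE.
rewrite /crossing !deg FE; congr (_ && (_ || [&& _, _ & ~~ _])).
apply/existsP/existsP => -[r]; last first.
  by exists (F r); rewrite !FE.
by rewrite -(permKV F r) !FE; exists (F^-1 r).
Qed.

(** Edges inside a copy are not crossing, so neither are their images, and each copy is
    connected. *)
Lemma aut_tail x y u : (F (x, u)).2 = (F (y, u)).2.
Proof.
have /connectP[p] := E_conn x y.
elim: p x => [|z p IHp] x /=; first by move=> _ ->.
case/andP=> xz pz /(IHp _ pz) <-; apply/eqP/negPn.
have := crossing_aut (x, u) (z, u).
by rewrite !crossingE (graph_autP _ _ F_aut) ext_rel_vert xz eqxx /= => ->.
Qed.

End Aut.

Lemma ext_aut_base (F : {perm V * W}) : F \in graph_aut ext_rel ->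
  exists2 s, s \in graph_aut base_rel & forall p, (F p).2 = s p.2.
Proof.
(* By [aut_tail] any letter would do in place of [h u]. *)
move=> F_aut; pose s u := (F (h u, u)).2.
have sE p : (F p).2 = s p.2 by case: p => x u; apply: aut_tail.
(* Apply [aut_tail] to the inverse of [F]: vertices with equal tails have preimages with equal
   tails. *)
have s_inj : injective s.
  have sK w : (F^-1 ((F (h w, w)).1, s w)).2 = w.
    by rewrite -surjective_pairing permK.
  move=> u v uv; rewrite -[LHS]sK -[RHS]sK -uv.
  exact: aut_tail (groupVr F_aut) _ _ _.
exists (perm s_inj) => [|p]; last by rewrite permE.
apply/graph_autP => u v; rewrite !permE !base_relE (inj_eq s_inj).
congr (_ && _); apply/existsP/existsP => -[x /existsP[y xy]]; last first.
  exists (F (x, u)).1; apply/existsP; exists (F (y, v)).1.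
  rewrite -[s u](sE (x, u)) -[s v](sE (y, v)) -!surjective_pairing.
  by rewrite (graph_autP _ _ F_aut).
move: xy; rewrite -(permKV F (x, s u)) -(permKV F (y, s v)).
have tl z w : (F^-1 (z, s w)).2 = w by apply: s_inj; rewrite -sE permKV.
rewrite (graph_autP _ _ F_aut).
case: (F^-1 _) (tl x u) => a _ /= ->; case: (F^-1 _) (tl y v) => b _ /= -> ab.
by exists a; apply/existsP; exists b.
Qed.

Lemma act_heads x y u : E x y -> act x y u != u ->
  h u = x /\ h (act x y u) = y \/ h u = y /\ h (act x y u) = x.
Proof.
move=> xy; rewrite act_fix // negb_and !negbK => /orP[] /eqP hu; [left | right].
  by rewrite h_actl.
by rewrite h_actr.
Qed.

Lemma ext_aut_tail_id (F : {perm V * W}) : F \in graph_aut ext_rel ->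
  (forall p, (F p).2 = p.2) -> F = 1.
Proof.
move=> F_aut F2; pose g u x := (F (x, u)).1.
have FE x u : F (x, u) = (g u x, u) by rewrite [LHS]surjective_pairing F2.
have g_inj u : injective (g u).
  move=> x y gxy; have : F (x, u) = F (y, u) by rewrite !FE gxy.
  by case/perm_inj.
have gE u x y : E x y -> E (g u x) (g u y).
  by rewrite -!(ext_rel_vert _ _ u) -!FE (graph_autP _ _ F_aut).
(* The image of a crossing edge joins the same two copies, so its end over [u] carries the first
   letter of one of the two tails. *)
have cross x y u : E x y -> act x y u != u ->
    h u = g u x \/ h (act x y u) = g u x.
  move=> xy uNv; have : ext_rel (x, u) (y, act x y u).
    by rewrite /ext_rel /= xy eqxx orbT.
  rewrite -(graph_autP _ _ F_aut) !FE => /andP[/= gxy]; rewrite (negPf uNv) /=.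
  move=> /eqP E_v; move: uNv; rewrite E_v => /(act_heads gxy).
  by case=> -[-> ->]; [left | right].
(* If [h u] were moved, [cross] would make its image equal to each of its two neighbours. *)
have g_hd u : g u (h u) = h u.
  have : 0 < #|E (h u)| by rewrite E_deg.
  case/card_gt0P=> x hx; have [z hz zx] := other_neighbour hx.
  have alt y : E (h u) y -> h u = g u (h u) \/ y = g u (h u).
    move=> hy; have := cross _ _ u hy; rewrite h_actl //; apply.
    by rewrite act_fix ?eqxx.
  have [//|xg] := alt x hx; have [//|zg] := alt z hz.
  by rewrite zg xg eqxx in zx.
apply/permP => -[x u]; rewrite perm1 FE; congr (_, _).
apply: (@fix_neighbours_id (g u) (h u)) => // [y z|y hy]; first exact: gE.
have yh : E y (h u) by rewrite E_sym.
(* The edge {y, h u} leads to a tail starting with [y], so [cross] leaves [h u] or [y] as image of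
   [y]; injectivity rules out [h u]. *)
have uNv : act y (h u) u != u by rewrite act_fix // eqxx andbF.
have [|] := cross _ _ _ yh uNv; last by rewrite h_actr.
by rewrite -{1}g_hd => /g_inj hy'; rewrite hy' E_irr in hy.
Qed.

End Extension.
End TwoRegular.

(** * Words, letterwise permutations and the induction on length *)

Section Letterwise.

Variable V : finType.

Lemma edge_actC (x y : V) : edge_act y x =1 edge_inv x y.
Proof. by elim=> //= z w ->. Qed.

Lemma edge_act_map (s : {perm V}) x y w :
  edge_act (s x) (s y) (map s w) = map s (edge_act x y w).
Proof.
elim: w => //= z w IHw; rewrite !(inj_eq perm_inj).
by do 2?case: eqP => //= _; rewrite IHw.
Qed.

Lemma edge_tuple_fix n (x y : V) (u : n.+1.-tuple V) : x != y ->
  (edge_tuple x y u == u) = (thead u != x) && (thead u != y).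
Proof.
case/tupleP: u => z u xy; rewrite theadE -val_eqE /=.
have [->|zx] := eqVneq z x; first by rewrite eqseq_cons eq_sym (negPf xy).
have [->|zy] := eqVneq z y; first by rewrite eqseq_cons (negPf xy).
by rewrite eqxx.
Qed.

Lemma edge_tuple_headl n (x y : V) (u : n.+1.-tuple V) :
  thead u = x -> thead (edge_tuple x y u) = y.
Proof.
case/tupleP: u => z u; rewrite theadE => ->.
by rewrite /thead (tnth_nth x) /= eqxx.
Qed.

Lemma edge_tuple_headr n (x y : V) (u : n.+1.-tuple V) :
  thead u = y -> thead (edge_tuple x y u) = x.
Proof.
case/tupleP: u => z u; rewrite theadE => ->.
by rewrite /thead (tnth_nth x) /= eqxx; case: eqP.
Qed.

Lemma letter_map_inj n (s : {perm V}) : injective (@map_tuple n V V s).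
Proof. by move=> u v /(congr1 val) /(inj_map perm_inj) /val_inj. Qed.

Definition letter_perm n (s : {perm V}) : {perm n.-tuple V} :=
  perm (@letter_map_inj n s).

Lemma letter_permE n s u : letter_perm n s u = map_tuple s u.
Proof. by rewrite permE. Qed.

Lemma letter_permM n : {morph letter_perm n : s t / s * t}.
Proof.
move=> s t; apply/permP => u; rewrite permM !letter_permE; apply: val_inj.
by rewrite /= -map_comp; apply: eq_map => x; rewrite permM.
Qed.

Lemma letter_perm_inj n : 0 < n -> injective (letter_perm n).
Proof.
case: n => // n _ s t st; apply/permP => x.
have := congr1 (fun f : {perm _} => f (nseq_tuple n.+1 x)) st.
by rewrite /= !letter_permE => /(congr1 val) /= [].
Qed.

Definition uncons_tuple n (u : n.+1.-tuple V) : V * n.-tuple V :=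
  (thead u, behead_tuple u).

Definition pair_cons n (p : V * n.-tuple V) : n.+1.-tuple V :=
  cons_tuple p.1 p.2.

Lemma uncons_tupleK n : cancel (@uncons_tuple n) (@pair_cons n).
Proof. by case/tupleP=> x u; apply: val_inj. Qed.

Lemma pair_consK n : cancel (@pair_cons n) (@uncons_tuple n).
Proof. by case=> x u; congr (_, _); apply: val_inj. Qed.

Lemma uncons_perm_inj n (f : {perm n.+1.-tuple V}) :
  injective (@uncons_tuple n \o f \o @pair_cons n).
Proof.
apply: inj_comp (can_inj (@pair_consK n)).
exact: inj_comp (can_inj (@uncons_tupleK n)) perm_inj.
Qed.

Definition uncons_perm n (f : {perm n.+1.-tuple V}) : {perm V * n.-tuple V} :=
  perm (@uncons_perm_inj n f).

Lemma uncons_permE n (f : {perm n.+1.-tuple V}) p :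
  uncons_perm f p = uncons_tuple (f (pair_cons p)).
Proof. by rewrite permE. Qed.

Variables (E : rel V) (E' : {set V * V}).
Hypothesis E'_or : is_orientation E E'.

(** A generator and its inverse are the actions of the two orders of one edge, so the orientation
    disappears. *)
Lemma schreier_graphE n u v :
  schreier_graph E' u v = base_rel E (@edge_tuple V n) u v.
Proof.
have [EE' _] := E'_or; rewrite /schreier_graph /base_rel /=; congr (_ && _).
have actE x y : edge_perm n x y u = edge_tuple x y u by rewrite permE.
have invE x y : (edge_perm n x y)^-1 u = edge_tuple y x u.
  apply: (canLR (permK _)); rewrite permE; apply: val_inj => /=.
  by rewrite [edge_act y x _]edge_actC edge_invK.
apply/exists_inP/existsP => [[[x y] /= xy]|[x /existsP[y]]].
  rewrite actE invE => /orP[] uv; [exists x|exists y]; apply/existsP.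
    by exists y; rewrite EE' xy.
  by exists x; rewrite EE' xy orbT.
rewrite EE' => /andP[/orP[] xy uv]; [exists (x, y) | exists (y, x)] => //=.
  by rewrite actE uv.
by rewrite invE uv orbT.
Qed.

Lemma letter_perm_aut n s : s \in graph_aut E ->
  letter_perm n s \in graph_aut (@schreier_graph V E' n).
Proof.
move=> /graph_autP sE; apply/graph_autP => u v.
rewrite !schreier_graphE /base_rel /= (inj_eq perm_inj); congr (_ && _).
have actE x y : edge_tuple (s x) (s y) (letter_perm n s u) =
    letter_perm n s (edge_tuple x y u).
  by apply: val_inj; rewrite !letter_permE /= edge_act_map.
apply/existsP/existsP => -[x /existsP[y]]; last first.
  move=> xy; exists (s x); apply/existsP; exists (s y).
  by rewrite sE actE (inj_eq perm_inj).
rewrite -(permKV s x) -(permKV s y) sE actE (inj_eq perm_inj) => xy.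
by exists (s^-1 x); apply/existsP; exists (s^-1 y).
Qed.

Hypothesis E_sym : symmetric E.
Hypothesis E_irr : irreflexive E.

Lemma edge_neq x y : E x y -> x != y.
Proof. by apply: contraTneq => ->; rewrite E_irr. Qed.

Lemma schreier_graph_cons n x y (u v : n.-tuple V) :
  schreier_graph E' (cons_tuple x u) (cons_tuple y v) =
  ext_rel E (@edge_tuple V n) (x, u) (y, v).
Proof.
rewrite schreier_graphE /base_rel /ext_rel /=.
apply/andP/andP => [[uv /existsP[a /existsP[b /andP[ab]]]]|[xy uv]].
  rewrite -!val_eqE /=; move: uv; rewrite -!val_eqE /=.
  have [->|xa] := eqVneq x a.
    by move=> _; rewrite eqseq_cons => /andP[/eqP-> ->]; rewrite ab orbT.
  have [->|xb] := eqVneq x b.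
    by move=> _; rewrite eqseq_cons => /andP[/eqP-> ->]; rewrite E_sym ab.
  by rewrite eq_sym => /negPf->.
have xNy := edge_neq xy; split.
  by rewrite -val_eqE eqseq_cons (negPf xNy).
(* The pair (y, x) sends xu to yu and stops there, while (x, y) goes on to act on the tail. *)
case/orP: uv => /eqP->; apply/existsP; [exists y | exists x]; apply/existsP.
  by exists x; rewrite E_sym xy -val_eqE /= (negPf xNy) eqxx.
by exists y; rewrite xy -val_eqE /= eqxx.
Qed.

Lemma schreier_graph_uncons n (u v : n.+1.-tuple V) : schreier_graph E' u v =
  ext_rel E (@edge_tuple V n) (uncons_tuple u) (uncons_tuple v).
Proof.
by rewrite -[u]uncons_tupleK -[v]uncons_tupleK !pair_consK schreier_graph_cons.
Qed.

Lemma uncons_perm_aut n (f : {perm n.+1.-tuple V}) :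
  f \in graph_aut (@schreier_graph V E' n.+1) ->
  uncons_perm f \in graph_aut (ext_rel E (@edge_tuple V n)).
Proof.
move=> /graph_autP fE; apply/graph_autP => p q.
rewrite !uncons_permE -schreier_graph_uncons fE schreier_graph_uncons.
by rewrite !pair_consK.
Qed.

Hypothesis E_deg : forall x, #|E x| = 2.
Hypothesis E_conn : forall x y, connect E x y.

Lemma schreier_aut n f : f \in graph_aut (@schreier_graph V E' n.+1) ->
  exists2 s, s \in graph_aut E & f = letter_perm n.+1 s.
Proof.
elim: n f => [|n IHn] f f_aut.
  (* The empty tail has no first letter, so length one is treated directly: there the Schreier graph
     is [E] itself. *)
  have fE := graph_autP _ _ f_aut.
  pose s x := thead (f (cons_tuple x [tuple])).
  have fs x : f (cons_tuple x [tuple]) = cons_tuple (s x) [tuple].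
    rewrite /s; case/tupleP: (f _) => y u; rewrite tuple0 theadE.
    exact: val_inj.
  have s_inj : injective s.
    move=> x y sxy; have := fs x; rewrite sxy -fs.
    by case/perm_inj/(congr1 val).
  exists (perm s_inj).
    apply/graph_autP => x y; rewrite !permE.
    have := fE (cons_tuple x [tuple]) (cons_tuple y [tuple]).
    by rewrite !fs !schreier_graph_cons !ext_rel_vert.
  apply/permP=> u; rewrite -[u]uncons_tupleK /pair_cons [_.2]tuple0 fs.
  by rewrite letter_permE; apply: val_inj; rewrite /= permE.
have fix_ x y u (xy : E x y) := @edge_tuple_fix n x y u (edge_neq xy).
have [psi psi_aut psiE] := ext_aut_base E_deg E_conn E_sym E_irr fix_
  (@edge_tuple_headl n) (@edge_tuple_headr n) (uncons_perm_aut f_aut).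
have [|s s_aut psi_s] := IHn psi.
  by apply/graph_autP => u v; rewrite !schreier_graphE (graph_autP _ _ psi_aut).
(* Both [f] and the letterwise action of [s] induce [psi] on tails, so their quotient preserves
   every copy. *)
exists s => //; apply/eqP; rewrite eq_mulgV1; apply/eqP.
set g := _ * _.
have g_aut : g \in graph_aut (@schreier_graph V E' n.+2).
  by rewrite groupM // groupV letter_perm_aut.
have g1 : uncons_perm g = 1.
  apply: (ext_aut_tail_id E_deg E_conn E_sym E_irr fix_
    (@edge_tuple_headl n) (@edge_tuple_headr n) (uncons_perm_aut g_aut)) => p.
  apply: (@perm_inj _ psi); rewrite -[RHS]psiE !uncons_permE /= psi_s letter_permE.
  have <- : letter_perm n.+2 s (g (pair_cons p)) = f (pair_cons p).
    by rewrite -permM mulgKV.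
  by rewrite letter_permE; apply: val_inj; rewrite /= behead_map.
apply/permP => u; rewrite perm1; apply: (can_inj (@uncons_tupleK _)).
by rewrite -{1}(uncons_tupleK u) -uncons_permE g1 perm1.
Qed.

Lemma schreier_aut_isog n : 0 < n ->
  graph_aut (@schreier_graph V E' n) \isog graph_aut E.
Proof.
case: n => // n _; rewrite isog_sym.
apply/isogP; pose m := Morphism (in2W (@letter_permM n.+1) :
  {in graph_aut E &, {morph letter_perm n.+1 : s t / s * t}}).
exists m; first by apply/injmP => s t _ _; apply: letter_perm_inj.
apply/setP => f; rewrite morphimEdom.
apply/imsetP/idP => [[s s_aut ->]|/schreier_aut //].
exact: letter_perm_aut.
Qed.

End Letterwise.

(** * The cycle on the integers modulo k + 3 and its dihedral automorphism group *)

Section Cycle.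

Variable k : nat.
Local Notation Zk := 'I_k.+3.
Local Notation C := (@cycle_graph k.+3).

Import GRing.Theory.
Local Open Scope ring_scope.

Lemma ordS_add1 (i : Zk) : ordS i = i + 1.
Proof. by apply: val_inj; rewrite /= (@modn_small 1) // addn1. Qed.

Lemma cycle_graphE (i j : Zk) : C i j = (j - i == 1) || (i - j == 1).
Proof. by rewrite /cycle_graph /= !ordS_add1 !subr_eq ![_ + 1]addrC. Qed.

(** True because the modulus is at least 3; it separates the two neighbours of a vertex, and
    reflections from rotations. *)
Lemma oneN1 : 1 != -1 :> Zk.
Proof. by rewrite -val_eqE /= !modn_small. Qed.

Lemma cycle_graph_deg (i : Zk) : #|C i| = 2%N.
Proof.
have /eq_card-> : C i =i pred2 (i + 1) (i - 1).
  move=> j; rewrite -[LHS]/(C i j) cycle_graphE inE /= subr_eq [1 + i]addrC.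
  by rewrite subr_eq [1 + j]addrC -[i == _]subr_eq [i - 1 == j]eq_sym.
by rewrite card2 (inj_eq (addrI i)) oneN1.
Qed.

Lemma cycle_graph_conn (i j : Zk) : connect C i j.
Proof.
suff H n : connect C i (i + n%:R).
  by have := H (val (j - i)); rewrite natr_Zp addrC subrK.
elim: n => [|n IHn]; first by rewrite addr0.
apply: connect_trans IHn (connect1 _).
by rewrite cycle_graphE -natr1 addrA [_ + 1]addrC addrK eqxx.
Qed.

Lemma refl_inj (a : Zk) : injective (fun i : Zk => a - i).
Proof. by move=> i j /addrI/oppr_inj. Qed.

Definition refl_perm (a : Zk) : {perm Zk} := perm (@refl_inj a).

Lemma refl_perm_aut a : refl_perm a \in graph_aut C.
Proof.
have subE x y : a - x - (a - y) = y - x by rewrite opprB addrC addrA subrK.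
by apply/graph_autP => i j; rewrite !permE !cycle_graphE !subE orbC.
Qed.

Lemma order_refl_perm a b : refl_perm a b != b -> #[refl_perm a]%g = 2%N.
Proof.
move=> ab; apply: nt_prime_order => //.
  by apply/permP => i; rewrite expgS expg1 permM !permE opprB addrC subrK.
by apply: contraNneq ab => ->; rewrite perm1.
Qed.

(* 1%R is annotated because 1 would be the neutral element 0 of the additive
   group in group_scope. *)
Definition dihedral_elt (p : bool * Zk) : {perm Zk} :=
  (refl_perm 0 ^+ p.1 * (refl_perm 0 * refl_perm 1%R) ^+ p.2)%g.

Lemma dihedral_eltE p i :
  dihedral_elt p i = (if p.1 then - i else i) + p.2.
Proof.
(* The left factor acts first, so j goes to -j and then to 1 + j. *)
have rotE n j : ((refl_perm 0 * refl_perm 1%R) ^+ n)%g j = j + n%:R.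
  elim: n => [|n IHn]; first by rewrite perm1 addr0.
  by rewrite expgSr permM IHn permM !permE sub0r opprK addrC -addrA natr1.
rewrite permM rotE natr_Zp; case: p => [[]] a /=.
  by rewrite permE sub0r.
by rewrite perm1.
Qed.

Lemma dihedral_elt_inj : injective dihedral_elt.
Proof.
move=> [b1 a1] [b2 a2] pE.
have aE : a1 = a2.
  have := congr1 (fun s : {perm Zk} => s 0) pE.
  by rewrite /= !dihedral_eltE /= oppr0 !if_same !add0r.
have := congr1 (fun s : {perm Zk} => s 1) pE; rewrite /= !dihedral_eltE /= aE.
move/addIr; case: b1 {pE}; case: b2 => // /eqP; rewrite 1?eq_sym.
  by rewrite (negPf oneN1).
by rewrite eq_sym (negPf oneN1).
Qed.

Lemma dihedral_elt_aut p : dihedral_elt p \in graph_aut C.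
Proof. by rewrite groupM ?groupX ?groupM ?refl_perm_aut. Qed.

Lemma cycle_graph_autE : graph_aut C = [set dihedral_elt p | p : bool * Zk].
Proof.
apply/setP => g; apply/idP/imsetP => [g_aut | [p _ ->]]; last first.
  exact: dihedral_elt_aut.
(* The image of 0 gives the translation, and g 1 - g 0, which is 1 or -1, gives the sign. The
   quotient then fixes the edge from 0 to 1 pointwise, so [fix_edge_id] applies. *)
pose p := (g 1 - g 0 != 1, g 0).
exists p => //; apply/eqP; rewrite eq_mulgV1; apply/eqP/permP => i.
have gE := graph_autP _ _ g_aut.
have eq_fix j : g j = dihedral_elt p j -> (g * (dihedral_elt p)^-1)%g j = j.
  by move=> gj; rewrite permM gj permK.
have C01 : C 0 1 by rewrite cycle_graphE subr0 eqxx.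
rewrite perm1; apply: (@fix_edge_id _ C cycle_graph_deg cycle_graph_conn
  (@cycle_graph_sym _) _ 0 1) => //; first exact: perm_inj.
- have /graph_autP h_aut := groupM g_aut (groupVr (dihedral_elt_aut p)).
  by move=> x y; rewrite h_aut.
- by apply: eq_fix; rewrite dihedral_eltE /= oppr0 if_same add0r.
apply: eq_fix; rewrite dihedral_eltE /=.
have := C01; rewrite -gE cycle_graphE; case: eqP => /= [g01 _|_ /eqP/(canRL (subrK _)) ->].
  exact: canRL (subrK _) g01.
by rewrite addKr.
Qed.

(** Two distinct involutions generate a dihedral group; its order comes from the unique normal form
    [dihedral_elt]. *)
Lemma cycle_graph_aut_dihedral : graph_aut C \isog 'D_(2 * k.+3)%N.
Proof.
have cardE : #|graph_aut C| = (2 * k.+3)%N.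
  rewrite cycle_graph_autE (card_imset _ dihedral_elt_inj).
  by rewrite card_prod card_bool card_ord.
have genE : <<[set refl_perm 0; refl_perm 1%R]>>%g = graph_aut C.
  apply/eqP; rewrite eqEsubset gen_subG; apply/andP; split.
    by apply/subsetP => s /set2P[] ->; apply: refl_perm_aut.
  rewrite cycle_graph_autE; apply/subsetP => _ /imsetP[p _ ->].
  by rewrite groupM ?groupX ?groupM ?mem_gen ?set21 ?set22.
have n0 : refl_perm 0 1 != 1 by rewrite permE sub0r eq_sym oneN1.
have n1 : refl_perm 1 0 != 0 by rewrite permE subr0 oner_neq0.
rewrite -cardE -genE.
apply: involutions_gen_dihedral (order_refl_perm n0) (order_refl_perm n1) _.
by apply: contraNneq n1 => <-; rewrite permE subr0.
Qed.

End Cycle.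

Theorem theorem4p1 (k n : nat) (E' : {set 'I_k * 'I_k})
    (hk : (3 <= k)%N) (hn : (1 <= n)%N)
    (hE' : is_orientation (@cycle_graph k) E') :
  (graph_aut (@schreier_graph 'I_k E' n) \isog graph_aut (@cycle_graph k)) /\
  (graph_aut (@cycle_graph k) \isog 'D_(2 * k)%N).
Proof.
case: k hk E' hE' => [|[|[|k]]] // _ E' hE'; split.
  apply: (schreier_aut_isog hE' _ _ (@cycle_graph_deg k) (@cycle_graph_conn k)) hn.
    exact: cycle_graph_sym.
  exact: cycle_graph_irr.
exact: cycle_graph_aut_dihedral.
Qed.
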